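(* Let $\underline{v}$ be a UD-word in the simple transpositions of $\mathfrak{S}_n$. If $u\in\mathfrak{S}_n$ satisfies $\mathbb{L}_{\underline{v}}(u)\neq\emptyset$, then $$\tilde{\mathcal{R}}_{u,\underline{v}}(t)=t^{c}(t^2+1)^{\frac{1}{2}(\ell(\underline{v})-\ell(u)-c)}$$ for some $c\in\mathbb{N}$, where $\ell(\underline{v})$ is the number of letters of $\underline{v}$ and $\ell(u)$ the Coxeter length of $u$.
   Context: $\mathfrak{S}_n$ has Coxeter generators $s_i=(i,i+1)$, $1\le i<n$. A word $\underline{v}$ is a UD-word if $\underline{v}=(s_{i_1}\cdots s_{i_r})\,s_t\,(s_{j_1}\cdots s_{j_q})$ with $1\le i_1<\cdots<i_r<t<n$ and $1\le j_q<\cdots<j_1<t<n$ (parenthesized parts may be empty; the word need not be reduced). Light leaves and diagrammatic polynomials: An $S$-graph is a finite planar graph with boundary in $\mathbb{R}\times[0,1]$, edges coloured by $S$, vertices either univalent (''dots'') or $2m_{st}$-valent ($m_{st}$ the order of $st$) with edges alternately coloured $s,t$; the top sequence is the word read on the top boundary; the degree is the number of dots. For a word $\underline{v}=s_1\cdots s_m$, the tree $\mathbb{T}_{\underline{v}}$ has root decorated by the empty diagram; a node of depth $k-1$ decorated by $D$ with top sequence a reduced expression $\underline{u}$ of $u$ has: if $\ell(us_k)>\ell(u)$, two children ($D$ plus an $s_k$-coloured straight strand on the right, top $\underline{u}s_k$; $D$ plus an $s_k$ strand ending in a dot on the right, top $\underline{u}$, degree $+1$); if $\ell(us_k)<\ell(u)$,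 one child obtained by stacking $2m_{st}$-valent vertices on $D$ realizing braid moves from $\underline{u}$ to a reduced expression $\underline{u}''s_k$, then joining the rightmost top $s_k$ strand to a new $s_k$ strand from the bottom by an arc (top $\underline{u}''$, degree unchanged). The leaves are light leaves; $\mathbb{L}_{\underline{v}}(u)$ is the set of those with top sequence a reduced expression of $u$ (for any admissible choice of braid moves), and $\tilde{\mathcal{R}}_{u,\underline{v}}(t)=\sum_{l\in\mathbb{L}_{\underline{v}}(u)}t^{\deg(l)}$. *)

(* Defs.v *)
From HB Require Import structures.
From mathcomp Require Import all_boot all_order all_algebra all_fingroup.

Set Implicit Arguments.
Unset Strict Implicit.
Unset Printing Implicit Defensive.

Import GRing.Theory.

Section CoxeterSymmetricGroup.

Variable n : nat.

(* Generators are indexed from 0: [i : gen n] names the transposition of the  *)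
(* points i and i.+1 of 'I_n = {0, ..., n-1}.                                 *)
Definition gen := 'I_n.-1.
Definition word := seq gen.

Lemma gen_lt (i : gen) : i < n.
Proof. exact: leq_trans (ltn_ord i) (leq_pred n). Qed.

Lemma genS_lt (i : gen) : i.+1 < n.
Proof. by rewrite -ltn_predRL ltn_ord. Qed.

Definition simple (i : gen) : 'S_n :=
  tperm (Ordinal (gen_lt i)) (Ordinal (genS_lt i)).

(* Permutations multiply left to right in perm.v. Since u |-> u^-1 is an      *)
(* anti-automorphism of 'S_n fixing each generator, the choice of composition *)
(* order is immaterial below.                                                 *)
Definition wprod (w : word) : 'S_n := (\prod_(i <- w) simple i)%g.

Definition has_expr (u : 'S_n) (k : nat) : bool :=
  [exists w : k.-tuple gen, wprod w == u].

Lemma has_exprP (u : 'S_n) :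
  (exists w : word, wprod w = u) -> exists k, has_expr u k.
Proof.
by case=> w <-; exists (size w); apply/existsP; exists (in_tuple w).
Qed.

Lemma expr_mul (u v : 'S_n) :
  (exists w, wprod w = u) -> (exists w, wprod w = v) ->
  exists w, wprod w = (u * v)%g.
Proof. by case=> a <- [b <-]; exists (a ++ b); rewrite /wprod big_cat. Qed.

Lemma expr_tperm_lt k (x y : 'I_n) : y = x + k.+1 :> nat ->
  exists w, wprod w = tperm x y.
Proof.
elim: k y => [|k IHk] y yE.
  have lti : x < n.-1.
    by rewrite ltn_predRL -[x.+1]addn1 -yE ltn_ord.
  exists [:: Ordinal lti]; rewrite /wprod big_seq1 /simple.
  by congr tperm; apply/val_inj; rewrite /= ?yE ?addn1.
have ltz : x + k.+1 < n.
  by apply: leq_ltn_trans (ltn_ord y); rewrite yE leq_add2l.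
pose z := Ordinal ltz.
have lti : z < n.-1.
  have yz : y = z.+1 :> nat by rewrite yE addnS.
  by rewrite ltn_predRL -yz ltn_ord.
have sE : simple (Ordinal lti) = tperm z y.
  by congr tperm; apply/val_inj; rewrite /= ?yE ?addnS.
have ezy : exists w, wprod w = tperm z y.
  by exists [:: Ordinal lti]; rewrite /wprod big_seq1.
have -> : tperm x y = (tperm z y * (tperm x z * tperm z y))%g.
  rewrite -{1}(tpermV z y) -/(conjg _ _) tpermJ tpermL tpermD //.
    by rewrite -val_eqE /= -[X in _ == X]addn0 eqn_add2l.
  by rewrite -val_eqE /= yE -[X in _ == X]addn0 eqn_add2l.
by apply: expr_mul => //; apply: expr_mul => //; apply: IHk.
Qed.

Lemma expr_ex (u : 'S_n) : exists w, wprod w = u.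
Proof.
have [ts -> _] := prod_tpermP u; apply: (big_ind (fun v => exists w, wprod w = v)).
- by exists [::]; rewrite /wprod big_nil.
- exact: expr_mul.
case=> x y _ /=; case: (ltngtP x y) => [lt|lt|/val_inj->].
- by apply: (@expr_tperm_lt (y - x.+1)); rewrite addnS -addSn subnKC.
- by rewrite tpermC; apply: (@expr_tperm_lt (x - y.+1)); rewrite addnS -addSn subnKC.
by rewrite tperm1; exists [::]; rewrite /wprod big_nil.
Qed.

Definition coxlen (u : 'S_n) : nat := ex_minn (has_exprP (expr_ex u)).

Definition reduced_expr (u : 'S_n) (w : word) : bool :=
  (wprod w == u) && (size w == coxlen u).

Definition coxm (s t : gen) : nat := #[simple s * simple t]%g.

(* s t s ... with k letters *)
Fixpoint alt (s t : gen) (k : nat) : word :=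
  if k is k'.+1 then s :: alt t s k' else [::].

(* S-graphs in the strip R x [0,1], presented by horizontal and vertical      *)
(* composition of elementary pieces; [Above E D] stacks E on top of D. The    *)
(* 2m-valent vertex has m edges going down and m going up, the 2m colours     *)
(* alternating around it; other repartitions are obtained with caps and cups. *)
Inductive diagram :=
  | Empty
  | Strand of gen
  | DotEnd of gen            (* edge from the bottom boundary ending in a dot *)
  | DotStart of gen          (* edge from a dot to the top boundary           *)
  | Cap of gen
  | Cup of gen
  | Vertex of gen & gen
  | Beside of diagram & diagram
  | Above of diagram & diagram.

Fixpoint bottom (D : diagram) : word :=
  match D with
  | Empty => [::]
  | Strand s => [:: s]
  | DotEnd s => [:: s]
  | DotStart _ => [::]
  | Cap s => [:: s; s]
  | Cup _ => [::]
  | Vertex s t => alt s t (coxm s t)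
  | Beside D1 D2 => bottom D1 ++ bottom D2
  | Above _ D2 => bottom D2
  end.

Fixpoint top (D : diagram) : word :=
  match D with
  | Empty => [::]
  | Strand s => [:: s]
  | DotEnd _ => [::]
  | DotStart s => [:: s]
  | Cap _ => [::]
  | Cup s => [:: s; s]
  | Vertex s t => alt t s (coxm s t)
  | Beside D1 D2 => top D1 ++ top D2
  | Above D1 _ => top D1
  end.

Fixpoint sgraph (D : diagram) : bool :=
  match D with
  | Vertex s t => s != t
  | Beside D1 D2 => sgraph D1 && sgraph D2
  | Above D1 D2 => [&& sgraph D1, sgraph D2 & bottom D1 == top D2]
  | _ => true
  end.

(* the number of dots *)
Fixpoint deg (D : diagram) : nat :=
  match D with
  | DotEnd _ | DotStart _ => 1
  | Beside D1 D2 | Above D1 D2 => deg D1 + deg D2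
  | _ => 0
  end.

Definition strands (w : word) : diagram :=
  foldr (fun s D => Beside (Strand s) D) Empty w.

(* [braid_stack D D']: D' is D with finitely many 2m-valent vertices stacked  *)
(* on top of it, each performing a braid move on the top sequence.            *)
Inductive braid_stack (D : diagram) : diagram -> Prop :=
  | BraidNil : braid_stack D D
  | BraidStep (D' : diagram) (a b : word) (s t : gen) :
      braid_stack D D' -> s != t -> top D' = a ++ alt s t (coxm s t) ++ b ->
      braid_stack D
        (Above (Beside (strands a) (Beside (Vertex s t) (strands b))) D').

Inductive tree :=
  | Leaf of diagram
  | Node1 of diagram & tree
  | Node2 of diagram & tree & tree.

Fixpoint leaves (T : tree) : seq diagram :=
  match T with
  | Leaf D => [:: D]
  | Node1 _ T1 => leaves T1
  | Node2 _ T1 T2 => leaves T1 ++ leaves T2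
  end.

(* [ll_subtree D w T]: T is an admissible tree below a node decorated by D    *)
(* when the letters w are still to be read; the braid moves may be chosen     *)
(* independently at each node.                                                *)
Inductive ll_subtree : diagram -> word -> tree -> Prop :=
  | LLleaf (D : diagram) : ll_subtree D [::] (Leaf D)
  | LLup (D : diagram) (s : gen) (w : word) (T1 T2 : tree) :
      coxlen (wprod (top D)) < coxlen (wprod (top D) * simple s)%g ->
      ll_subtree (Beside D (Strand s)) w T1 ->
      ll_subtree (Beside D (DotEnd s)) w T2 ->
      ll_subtree D (s :: w) (Node2 D T1 T2)
  | LLdown (D : diagram) (s : gen) (w : word) (D' : diagram) (u'' : word)
      (T1 : tree) :
      coxlen (wprod (top D) * simple s)%g < coxlen (wprod (top D)) ->
      braid_stack D D' -> top D' = rcons u'' s ->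
      ll_subtree (Above (Beside (strands u'') (Cap s)) (Beside D' (Strand s)))
        w T1 ->
      ll_subtree D (s :: w) (Node1 D T1).

Definition ll_tree (v : word) (T : tree) : Prop := ll_subtree Empty v T.

Definition light_leaves (T : tree) (u : 'S_n) : seq diagram :=
  [seq l <- leaves T | reduced_expr u (top l)].

(* Distinct leaves of T are distinct S-graphs: below a node with two children *)
(* at depth k-1, the k-th bottom endpoint is joined to a dot on one side only.*)
(* So this is the sum over the set of light leaves.                           *)
Definition Rtilde (T : tree) (u : 'S_n) : {poly int} :=
  (\sum_(l <- light_leaves T u) 'X^(deg l))%R.

Definition UD_word (v : word) : Prop :=
  exists (I J : word) (t : gen),
    [/\ v = I ++ t :: J,
        sorted ltn [seq val i | i <- rcons I t]
      & sorted gtn [seq val j | j <- t :: J]].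

Lemma strandsP (w : word) :
  [/\ bottom (strands w) = w, top (strands w) = w & sgraph (strands w)].
Proof. by elim: w => //= s w [-> -> ->]. Qed.

Lemma braid_stackP (D D' : diagram) : braid_stack D D' ->
  sgraph D -> sgraph D' /\ bottom D' = bottom D.
Proof.
elim=> // {}D' a b s t _ IH neq topE /IH[wD' <-] /=.
have [-> _ ->] := strandsP a; have [-> _ ->] := strandsP b.
by rewrite neq wD' topE eqxx.
Qed.

Lemma ll_subtreeP (D : diagram) (w : word) (T : tree) : ll_subtree D w T ->
  sgraph D -> all (fun l => sgraph l && (bottom l == bottom D ++ w)) (leaves T).
Proof.
elim=> {D w T} [D wD|D s w T1 T2 _ _ IH1 _ IH2 wD|].
- by rewrite /= wD cats0 eqxx.
- by move: IH1 IH2; rewrite /= all_cat wD -catA => -> // ->.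
move=> D s w D' u'' T1 _ /braid_stackP bs topE _ IH /bs[wD' bE] /=.
move: IH => /=; have [-> _ ->] := strandsP u''.
by rewrite wD' topE bE -cats1 -!catA eqxx /=; apply.
Qed.

Lemma light_leaf_sgraph (v : word) (T : tree) : ll_tree v T ->
  all (fun l => sgraph l && (bottom l == v)) (leaves T).
Proof. by move=> /ll_subtreeP; apply. Qed.

End CoxeterSymmetricGroup.

(* Main.v *)
(* The generating function of the leaves ending at u is the coefficient of   *)
(* T_u in the product of the T_s^-1 = T_s + X, s ranging over the letters of  *)
(* v, in the Hecke algebra. In a UD-word the smallest letter a occurs only at *)
(* the two ends, so v is a v', v' a or a v' a where v' lies in the parabolic  *)
(* subgroup W' of the permutations fixing all points up to a. Passing from v' *)
(* to v, the coefficient at u comes from a single element of W' and gets      *)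
(* multiplied by 1, X, X^2 or X^2 + 1, the last one when v = a v' a and u in  *)
(* W' commutes with a.                                                        *)

Require Import Defs.
From HB Require Import structures.
From mathcomp Require Import all_boot all_order all_algebra all_fingroup.
From mathcomp Require Import ring zify.

Set Implicit Arguments.
Unset Strict Implicit.
Unset Printing Implicit Defensive.

Import GRing.Theory.

(** * Coxeter length, exchange, and ascents read off inverse permutations *)

Section Length.

Variable n : nat.
Implicit Types (u w : 'S_n) (i s t : gen n) (v : word n).

(** The tree branches as multiplication by [T_s + X] does: [T_w] goes to [T_(ws) + X T_w] at an
    ascent and to [T_(ws)] at a descent. Braid moves affect neither the element nor the degree, so
    the leaf polynomial depends only on the word and [u] ([sum_leaves]).

    Let P(u) be this polynomial for a word with all letters larger than [a]. It vanishes off the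
    parabolic subgroup W'. Adding [a] at both ends replaces P(u) by P(aua) + X P(ua), plus X P(au) +
    X^2 P(u) when [u] ascends at [a] ([leaf_poly_cons], [leaf_poly_rcons]). For each [u] only one
    element of W' contributes; it counts twice only if [u] is in W' and commutes with [a], which
    produces the factor X^2 + 1 ([par_conj], [factored_both]). Peeling off the smallest letter
    proves the theorem by induction ([factored_UD]), lengths being tracked by [coxlen_parl],
    [coxlen_parr] and [coxlen_conj]. *)

Definition lpt i : 'I_n := Ordinal (gen_lt i).
Definition rpt i : 'I_n := Ordinal (genS_lt i).

Lemma simpleK u i : (u * simple i * simple i = u)%g.
Proof. by rewrite -mulgA tperm2 mulg1. Qed.

Lemma simpleKl u i : (simple i * (simple i * u) = u)%g.
Proof. by rewrite mulgA tperm2 mul1g. Qed.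

Lemma simple_lpt i : simple i (lpt i) = rpt i. Proof. exact: tpermL. Qed.
Lemma simple_rpt i : simple i (rpt i) = lpt i. Proof. exact: tpermR. Qed.

Lemma simple_out i (x : 'I_n) : (x < i) || (i.+1 < x) -> simple i x = x.
Proof. by move=> xP; rewrite tpermD //; apply/eqP=> /(congr1 val) /=; lia. Qed.

Lemma val_simple i (x : 'I_n) :
  val (simple i x) = if val x == i then i.+1 else if val x == i.+1 then val i else x.
Proof.
rewrite /simple; case: tpermP => [->|->|/eqP + /eqP +]; rewrite -?val_eqE /=.
- by rewrite eqxx.
- by rewrite eqxx gtn_eqF.
by do 2!move=> /negPf->.
Qed.

Lemma wprod_cat v1 v2 : wprod (v1 ++ v2) = (wprod v1 * wprod v2)%g.
Proof. exact: big_cat. Qed.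

Lemma wprod_rcons v s : wprod (rcons v s) = (wprod v * simple s)%g.
Proof. by rewrite -cats1 wprod_cat /wprod big_seq1. Qed.

Lemma wprod_cons s v : wprod (s :: v) = (simple s * wprod v)%g.
Proof. exact: big_cons. Qed.

Lemma wprod_rev v : wprod (rev v) = ((wprod v)^-1)%g.
Proof.
elim: v => [|s v IHv]; first by rewrite /wprod !big_nil invg1.
by rewrite rev_cons wprod_rcons IHv wprod_cons invMg tpermV.
Qed.

Lemma coxlen_wprod v : coxlen (wprod v) <= size v.
Proof.
rewrite /coxlen; case: ex_minnP => m _; apply.
by apply/existsP; exists (in_tuple v).
Qed.

Lemma coxlen_ex u : exists2 v, wprod v = u & size v = coxlen u.
Proof.
rewrite /coxlen; case: ex_minnP => m /existsP[v /eqP vu] _.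
by exists v; rewrite ?size_tuple.
Qed.

Lemma coxlenV u : coxlen (u^-1)%g = coxlen u.
Proof.
have le w : coxlen (w^-1)%g <= coxlen w.
  have [v <- <-] := coxlen_ex w.
  by rewrite -wprod_rev (leq_trans (coxlen_wprod _)) // size_rev.
by apply/eqP; rewrite eqn_leq le -{1}(invgK u) le.
Qed.

Lemma coxlen1 : coxlen (1 : 'S_n)%g = 0.
Proof.
have := coxlen_wprod [::]; rewrite /wprod big_nil /=.
by rewrite leqn0 => /eqP.
Qed.

Lemma coxlen_simple_le u s : coxlen (u * simple s)%g <= (coxlen u).+1.
Proof.
have [v <- <-] := coxlen_ex u.
by rewrite -wprod_rcons (leq_trans (coxlen_wprod _)) // size_rcons.
Qed.

(* The exchange condition: an inversion (x, y) of [wprod v] is created at one *)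
(* letter of v, and cancelling it amounts to deleting that letter.            *)
Lemma wprod_exchange v (x y : 'I_n) : x < y -> wprod v y < wprod v x ->
  exists2 v', wprod v' = (tperm x y * wprod v)%g & size v = (size v').+1.
Proof.
elim: v x y => [|s v IHv] x y ltxy.
  by rewrite /wprod big_nil !perm1; lia.
rewrite wprod_cons !permM => inv.
have [lts|ges] := ltnP (simple s x) (simple s y).
  have [v' v'E sv'] := IHv _ _ lts inv.
  exists (s :: v'); last by rewrite /= sv'.
  by rewrite wprod_cons v'E -tpermJ /conjg tpermV -/(simple s) -!mulgA simpleKl.
suff -> : tperm x y = simple s by exists v; rewrite ?simpleKl.
have [/val_inj-> /val_inj-> //] : x = lpt s :> nat /\ y = rpt s :> nat.
move: ges ltxy; rewrite !val_simple /=.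
by repeat (case: eqP => ?); lia.
Qed.

Lemma simple_tperm_inv u s :
  (tperm (u^-1 (lpt s)) (u^-1 (rpt s)) * u = u * simple s)%g.
Proof. by rewrite -tpermJ /conjg invgK -!mulgA mulVg mulg1. Qed.

(** The values at [s] come from an inversion of [u], so exchange deletes a letter from a reduced
    word; one more letter lengthens by at most one. *)
Lemma coxlen_down u s : (u^-1)%g (rpt s) < (u^-1)%g (lpt s) ->
  coxlen u = (coxlen (u * simple s)%g).+1.
Proof.
move=> lt; have [v vu sv] := coxlen_ex u.
have := wprod_exchange lt; rewrite tpermC => /(_ v).
rewrite vu !permKV simple_tperm_inv => /(_ (ltnSn _)) [v' v'u sv'].
have := coxlen_wprod v'; rewrite v'u.
by have := coxlen_simple_le (u * simple s)%g s; rewrite simpleK; lia.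
Qed.

Lemma coxlen_up u s : (u^-1)%g (lpt s) < (u^-1)%g (rpt s) ->
  coxlen (u * simple s)%g = (coxlen u).+1.
Proof.
move=> lt; rewrite -{2}(simpleK u s); apply: coxlen_down.
by rewrite invMg tpermV !permM -/(simple s) simple_lpt simple_rpt.
Qed.

End Length.

(** * Light leaves as Hecke algebra coefficients *)

Section LeafPolynomial.

Variable n : nat.
Implicit Types (u w : 'S_n) (s : gen n) (v : word n).
Local Open Scope ring_scope.

Definition ascent u s := (coxlen u < coxlen (u * simple s)%g)%N.

(* Coefficient of T_u in T_w * prod_s T_s^-1, s ranging over v, in the Hecke  *)
(* algebra with T_s^-1 = T_s + X.                                             *)
Fixpoint leaf_poly w v u : {poly int} :=
  if v is s :: v' then
    leaf_poly (w * simple s)%g v' u + (ascent w s)%:R * 'X * leaf_poly w v' u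
  else (w == u)%:R.

Lemma leaf_poly_rcons w v s u :
  leaf_poly w (rcons v s) u =
  leaf_poly w v (u * simple s)%g + (ascent u s)%:R * 'X * leaf_poly w v u.
Proof.
elim: v w => [|r v IHv] w /=; last by rewrite !IHv; ring.
have -> : (w * simple s == u)%g = (w == u * simple s)%g.
  by apply/idP/idP=> /eqP; [move=> <- | move=> ->]; rewrite simpleK.
by case: (w =P u) => [->|_]; rewrite ?mulr0.
Qed.

(** When [k] is the order of st the power disappears, which is the braid relation. *)
Lemma wprod_alt (s t : gen n) k :
  wprod (alt s t k) = ((simple s * simple t) ^+ k * wprod (alt t s k))%g.
Proof.
elim: k s t => [|k IHk] s t; first by rewrite mul1g.
rewrite /= !wprod_cons IHk expgSr !mulgA simpleK; congr (_ * _)%g.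
elim: k {IHk} => [|k IHk]; first by rewrite !expg0 mul1g mulg1.
by rewrite !expgSr [LHS]mulgA IHk !mulgA.
Qed.

Lemma wprod_braid (s t : gen n) :
  wprod (alt s t (coxm s t)) = wprod (alt t s (coxm s t)).
Proof. by rewrite wprod_alt expg_order mul1g. Qed.

Lemma size_alt (s t : gen n) k : size (alt s t k) = k.
Proof. by elim: k s t => //= k IHk s t; rewrite IHk. Qed.

Lemma deg_strands v : deg (strands v) = 0%N.
Proof. by elim: v. Qed.

Lemma top_strands v : top (strands v) = v.
Proof. by case: (strandsP v). Qed.

Lemma braid_stack_inv (D D' : diagram n) : braid_stack D D' ->
  [/\ wprod (top D') = wprod (top D), size (top D') = size (top D)
    & deg D' = deg D].
Proof.
elim=> // {}D' a b s t _ [<- <- <-] _ ->; rewrite /= !deg_strands !top_strands.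
by rewrite !wprod_cat wprod_braid !size_cat !size_alt.
Qed.

(** The invariant is that every node has a reduced top sequence, so a leaf counts for [u] exactly
    when its top word multiplies to [u]. *)
Lemma sum_leaves (D : diagram n) v T u : ll_subtree D v T ->
  size (top D) = coxlen (wprod (top D)) ->
  \sum_(l <- leaves T | reduced_expr u (top l)) 'X^(deg l) =
  'X^(deg D) * leaf_poly (wprod (top D)) v u.
Proof.
elim=> {D v T} [D|D s v T1 T2 up _ IH1 _ IH2|D s v D' u'' T1 down bs topE _ IH]
  szD.
- rewrite /= big_mkcond big_seq1 /reduced_expr szD.
  by case: eqP => [->|_]; rewrite ?eqxx ?mulr1 ?mulr0.
- rewrite /= big_cat /= /ascent up mul1r.
  rewrite {}IH1 ?{}IH2 /= ?cats0 ?cats1 ?wprod_rcons ?size_rcons //.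
    by rewrite addn0 addn1 exprSr; ring.
  by have := coxlen_simple_le (wprod (top D)) s; move: up szD; lia.
have [wD' sD' dD'] := braid_stack_inv bs.
have uE : wprod u'' = (wprod (top D) * simple s)%g.
  by rewrite -wD' topE wprod_rcons simpleK.
rewrite /= /ascent ltnNge (ltnW down) !mul0r addr0.
rewrite {}IH /= cats0 top_strands ?deg_strands ?addn0 ?add0n uE ?dD' //.
(* [u''] is reduced: it is one letter shorter than a reduced word, and the length drops by at most
   one. *)
have := coxlen_simple_le (wprod (top D) * simple s)%g s; rewrite simpleK.
by have := coxlen_wprod u''; move: sD'; rewrite uE topE size_rcons; lia.
Qed.

Lemma Rtilde_leaf_poly v T u : ll_tree v T -> Rtilde T u = leaf_poly 1%g v u.
Proof.
move=> /sum_leaves sumE; rewrite /Rtilde /light_leaves big_filter sumE.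
  by rewrite /= mul1r /wprod big_nil.
by rewrite /wprod big_nil coxlen1.
Qed.

(** Evaluation at 1 counts the light leaves, so no cancellation can occur. *)
Lemma Rtilde_neq0 (T : tree n) u : light_leaves T u <> [::] -> Rtilde T u <> 0.
Proof.
move=> ne0 /(congr1 (fun p => p.[1])) /eqP; rewrite /Rtilde horner_sum horner0.
rewrite (eq_bigr (fun=> 1)) => [|l _]; last by rewrite hornerXn expr1n.
rewrite big_const_seq count_predT iter_addr_0 Num.Theory.pnatr_eq0.
by move/nilP.
Qed.

End LeafPolynomial.

(** * Adding the smallest letter at either end *)

Section Peeling.

Variables (n : nat) (a : gen n).
Implicit Types (u w : 'S_n) (v : word n).
Local Open Scope ring_scope.

(* The parabolic subgroup generated by the letters larger than a.             *)
Definition par w : bool := [forall x : 'I_n, (x <= a)%N ==> (w x == x)].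

Definition above v := all (fun i : gen n => (a < i)%N) v.

Lemma parP w : reflect (forall x : 'I_n, (x <= a)%N -> w x = x) (par w).
Proof.
by apply: (iffP forallP) => h x; [move=> /(implyP (h x))/eqP | apply/implyP=> /h/eqP].
Qed.

Lemma parM u w : par u -> par w -> par (u * w)%g.
Proof. by move=> /parP pu /parP pw; apply/parP => x lex; rewrite permM pu ?pw. Qed.

Lemma parV w : par w -> par (w^-1)%g.
Proof. by move=> /parP pw; apply/parP => x lex; rewrite -{1}(pw x lex) permK. Qed.

Lemma par_simple (i : gen n) : (a < i)%N -> par (simple i).
Proof. by move=> lt; apply/parP=> x lex; apply: simple_out; lia. Qed.

Lemma leaf_poly_par v u : above v -> ~~ par u -> leaf_poly 1%g v u = 0.
Proof.
elim/last_ind: v u => [|v s IHv] u.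
  move=> _ npu; rewrite /=; case: eqP => // uE; case/negP: npu.
  by apply/parP => x _; rewrite -uE perm1.
rewrite /above all_rcons => /andP[lts av] npu.
rewrite leaf_poly_rcons !IHv ?mulr0 ?addr0 //; apply: contra npu => pus.
by rewrite -(simpleK u s) parM // par_simple.
Qed.

Lemma par_lpt w : par w -> w (lpt a) = lpt a.
Proof. by move/parP; apply. Qed.

Lemma par_rpt w : par w -> (a < w (rpt a))%N.
Proof.
move=> pw; rewrite ltnNge; apply/negP => le.
have /parP /(_ _ le) := parV pw; rewrite permK => /(congr1 val) /=.
by move=> E; move: le; rewrite -E ltnn.
Qed.

Lemma par_mulr w : par w -> ~~ par (w * simple a)%g.
Proof.
move=> pw; apply/negP => /par_lpt; rewrite permM par_lpt // simple_lpt.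
by move/(congr1 val) => /=; lia.
Qed.

Lemma par_mull w : par w -> ~~ par (simple a * w)%g.
Proof.
move=> pw; apply/negP => /par_lpt; rewrite permM simple_lpt => E.
by have := par_rpt pw; rewrite E /= ltnn.
Qed.

Lemma coxlen_parr w : par w -> coxlen (w * simple a)%g = (coxlen w).+1.
Proof. by move=> /parV pw; apply: coxlen_up; rewrite par_lpt ?par_rpt. Qed.

Lemma coxlen_parl w : par w -> coxlen (simple a * w)%g = (coxlen w).+1.
Proof.
by move=> /parV pw; rewrite -coxlenV invMg tpermV coxlen_parr ?coxlenV.
Qed.

Lemma ascent_par w : par w -> ascent w a.
Proof. by move=> pw; rewrite /ascent coxlen_parr. Qed.

(** Left multiplication by [a] adds one to every length in W', so comparisons inside W' survive. *)
Lemma ascent_parl w (s : gen n) : par w -> (a < s)%N ->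
  ascent (simple a * w)%g s = ascent w s.
Proof.
by move=> pw lts; rewrite /ascent -mulgA !coxlen_parl // parM ?par_simple.
Qed.

(** This is [T_a T_w = T_(aw)] on W'. The recursion reads from the left, so the induction must run
    on the last letter, where [ascent_parl] matches the two ascents. *)
Lemma leaf_poly_cons v u : above v ->
  leaf_poly 1%g (a :: v) u =
  leaf_poly 1%g v (simple a * u)%g + 'X * leaf_poly 1%g v u.
Proof.
elim/last_ind: v u => [|v s IHv] u.
  move=> _; rewrite /= ascent_par ?mul1g ?mul1r; last first.
    by apply/parP=> x _; rewrite perm1.
  have -> : (simple a == u)%g = (1 == simple a * u)%g; last by [].
  apply/idP/idP=> /eqP; first by move=> <-; rewrite tperm2.
  by move=> E; rewrite -(simpleKl u a) -E mulg1.
rewrite /above all_rcons => /andP[lts av].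
rewrite -rcons_cons !leaf_poly_rcons !IHv // -!mulgA.
have [pu|/(leaf_poly_par av)->] := boolP (par (simple a * u)%g); last by ring.
by rewrite -(ascent_parl pu lts) simpleKl; ring.
Qed.

Lemma par_fix_conj w : par w -> w (rpt a) = rpt a ->
  (simple a * (w * simple a))%g = w.
Proof.
move=> pw wr; have wJ : (simple a ^ w = simple a)%g.
  by rewrite tpermJ -/(lpt a) -/(rpt a) par_lpt ?wr.
by rewrite -[X in (w * X)%g]wJ -conjgC simpleKl.
Qed.

Lemma par_conj w : par w -> par (simple a * (w * simple a))%g ->
  (simple a * (w * simple a))%g = w.
Proof.
move=> pw pJ; apply: par_fix_conj => //; move/par_lpt: pJ.
rewrite !permM simple_lpt => /(congr1 (simple a)).
by rewrite simple_lpt -[LHS]permM tperm2 perm1.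
Qed.

Lemma coxlen_conj w : par w -> ~~ par (simple a * (w * simple a))%g ->
  coxlen (simple a * (w * simple a))%g = (coxlen w).+2.
Proof.
move=> pw npw; rewrite mulgA coxlen_up ?coxlen_parl //.
have pV := parV pw.
rewrite invMg tpermV -/(simple a) !permM par_lpt // simple_lpt.
(* If [w^-1] fixed a+1, then [w] would commute with [a] and the conjugate would lie in W'. *)
have gt : (a.+1 < (w^-1)%g (rpt a))%N.
  rewrite ltn_neqAle par_rpt // andbT; apply: contra npw => /eqP E.
  rewrite par_fix_conj //.
  have {1}-> : rpt a = (w^-1)%g (rpt a) by apply/val_inj.
  by rewrite permKV.
by rewrite simple_out ?gt ?orbT.
Qed.

(** Zero is allowed so that the induction can range over all [u]; the equation on [c] and [k]
    encodes both the exponent and its parity. *)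
Definition factored v := forall u, leaf_poly 1%g v u = 0 \/
  exists c k, (c + k.*2 + coxlen u)%N = size v /\
    leaf_poly 1%g v u = 'X^c * ('X^2 + 1) ^+ k.

Lemma factored_cons v : above v -> factored v -> factored (a :: v).
Proof.
move=> av pv u; rewrite leaf_poly_cons //.
have [pu|npu] := boolP (par u).
  rewrite (leaf_poly_par av (par_mull pu)) add0r.
  case: (pv u) => [->|[c [k [E ->]]]]; first by left; rewrite mulr0.
  by right; exists c.+1, k; split; [rewrite /= -E; lia | rewrite (exprS _ c); ring].
rewrite (leaf_poly_par av npu) mulr0 addr0.
have [pau|npau] := boolP (par (simple a * u)%g); last first.
  by left; apply: leaf_poly_par.
case: (pv (simple a * u)%g) => [->|[c [k [E ->]]]]; [by left | right].
exists c, k; split=> //; have := coxlen_parl pau; rewrite simpleKl /=; lia.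
Qed.

Lemma factored_rcons v : above v -> factored v -> factored (rcons v a).
Proof.
move=> av pv u; rewrite leaf_poly_rcons // size_rcons.
have [pu|npu] := boolP (par u).
  rewrite (leaf_poly_par av (par_mulr pu)) add0r ascent_par // mul1r.
  case: (pv u) => [->|[c [k [E ->]]]]; first by left; rewrite mulr0.
  by right; exists c.+1, k; split; [rewrite /= -E; lia | rewrite (exprS _ c); ring].
rewrite (leaf_poly_par av npu) mulr0 addr0.
have [pua|npua] := boolP (par (u * simple a)%g); last first.
  by left; apply: leaf_poly_par.
case: (pv (u * simple a)%g) => [->|[c [k [E ->]]]]; [by left | right].
exists c, k; split=> //; have := coxlen_parr pua; rewrite simpleK /=; lia.
Qed.

Lemma factored_both v : above v -> factored v -> factored (a :: rcons v a).
Proof.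
move=> av pv u; rewrite -rcons_cons leaf_poly_rcons !leaf_poly_cons //.
rewrite [size _]/= size_rcons.
have [pu|npu] := boolP (par u).
  rewrite (leaf_poly_par av (par_mulr pu)) (leaf_poly_par av (par_mull pu)).
  rewrite ascent_par // mulr0 addr0 add0r mul1r.
  (* Here [u] and its conjugate coincide, so the contributions P(u) and X^2 P(u) add up. *)
  have [/(par_conj pu)->|npJ] := boolP (par (simple a * (u * simple a))%g).
    case: (pv u) => [->|[c [k [E ->]]]]; first by left; rewrite !mulr0 addr0.
    right; exists c, k.+1; split; first by rewrite -E; lia.
    by rewrite (exprS _ k); ring.
  rewrite (leaf_poly_par av npJ) add0r.
  case: (pv u) => [->|[c [k [E ->]]]]; first by left; rewrite !mulr0.
  right; exists c.+2, k; split; first by rewrite -E; lia.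
  by rewrite (exprS _ c.+1) (exprS _ c); ring.
rewrite (leaf_poly_par av npu) mulr0 addr0.
have [pua|npua] := boolP (par (u * simple a)%g).
  rewrite (leaf_poly_par av (par_mull pua)) add0r.
  have lenu := coxlen_parr pua; rewrite simpleK in lenu.
  (* [u] descends at [a], which kills the terms X P(au) and X^2 P(u). *)
  rewrite /ascent lenu ltnNge leqnSn !mul0r addr0.
  case: (pv (u * simple a)%g) => [->|[c [k [E ->]]]]; first by left; rewrite mulr0.
  right; exists c.+1, k; split; first by rewrite -E; lia.
  by rewrite (exprS _ c); ring.
rewrite (leaf_poly_par av npua) mulr0 addr0.
have [pau|npau] := boolP (par (simple a * u)%g).
  have lenu := coxlen_parl pau; rewrite simpleKl in lenu.
  rewrite mulgA (leaf_poly_par av (par_mulr pau)) add0r.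
  case: ascent; [rewrite mul1r | by left; rewrite !mul0r].
  case: (pv (simple a * u)%g) => [->|[c [k [E ->]]]]; first by left; rewrite mulr0.
  right; exists c.+1, k; split; first by rewrite -E; lia.
  by rewrite (exprS _ c); ring.
rewrite (leaf_poly_par av npau) mulr0 addr0.
have [pJ|npJ] := boolP (par (simple a * (u * simple a))%g); last first.
  by left; apply: leaf_poly_par.
have lenu := coxlen_conj pJ.
rewrite -!mulgA tperm2 mulg1 simpleKl in lenu.
case: (pv (simple a * (u * simple a))%g) => [->|[c [k [E ->]]]]; [by left | right].
by exists c, k; split=> //; have := lenu npu; lia.
Qed.

End Peeling.

(** * Induction on UD-words *)

Section UDWords.

Variable n : nat.
Implicit Types (I J v : word n) (t : gen n).

Lemma factored_nil : factored (Nil (gen n)).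
Proof.
move=> u /=; case: eqP => [<-|_]; [right | by left].
by exists 0, 0; rewrite coxlen1 expr0 mulr1.
Qed.

Lemma sorted_above (i : gen n) I t : sorted ltn [seq val i | i <- rcons (i :: I) t] ->
  above i (rcons I t).
Proof.
by rewrite /= (path_sortedE ltn_trans) all_map => /andP[].
Qed.

Lemma sorted_below (j : gen n) J t : sorted gtn [seq val j | j <- t :: rcons J j] ->
  above j (t :: J).
Proof.
rewrite -rcons_cons map_rcons -rev_sorted rev_rcons /=.
rewrite (path_sortedE ltn_trans) all_rev => /andP[+ _].
by rewrite -map_cons all_map.
Qed.

Lemma sorted_init (j : gen n) J t : sorted gtn [seq val j | j <- t :: rcons J j] ->
  sorted gtn [seq val j | j <- t :: J].
Proof. by rewrite -rcons_cons map_rcons -cats1 => /cat_sorted2[]. Qed.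

Lemma factored_UD I t J :
  sorted ltn [seq val i | i <- rcons I t] ->
  sorted gtn [seq val j | j <- t :: J] -> factored (I ++ t :: J).
Proof.
have [m] := ubnP (size I + size J); elim: m I J => // m IHm I J.
case: I => [|i I]; case/lastP: J => [|J j].
- by move=> _ _ _; apply: (factored_cons _ factored_nil).
- rewrite /= size_rcons => szm sI sJ.
  rewrite -rcons_cons; apply: factored_rcons (sorted_below sJ) _.
  apply: (IHm [::] J) => //.
  exact: sorted_init sJ.
- rewrite /= addn0 => szm sI sJ; have ai := sorted_above sI; rewrite -cats1 in ai.
  apply: factored_cons => //; apply: (IHm I [::]) => //; first by rewrite addn0.
  exact: path_sorted sI.
rewrite /= size_rcons => szm sI sJ; have ai := sorted_above sI.
have aj := sorted_below sJ; have sJ' := sorted_init sJ.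
have sI' := path_sorted sI.
have aI : above i I by move: ai; rewrite /above all_rcons => /andP[].
have tr (k l : gen n) v : l <= k -> above k v -> above l v.
  by move=> lk; apply: sub_all => x; apply: leq_ltn_trans.
have [ltij|ltji|/val_inj eij] := ltngtP i j.
(* The smallest letter is the smaller of the two end letters; equal ends must be removed
   together. *)
- apply: factored_cons; last by apply: IHm; rewrite ?size_rcons.
  rewrite /above all_cat -rcons_cons all_rcons ltij -!/(above _ _) aI.
  exact: tr (ltnW ltij) aj.
- rewrite -rcons_cons -rcons_cat -rcons_cons; apply: factored_rcons.
    rewrite /above [all _ _]/= ltji all_cat -!/(above _ _) aj andbT.
    exact: tr (ltnW ltji) aI.
  by apply: (IHm (i :: I)) => //=; lia.
rewrite -rcons_cons -rcons_cat -eij; apply: factored_both.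
  by rewrite /above all_cat -!/(above _ _) aI eij.
by apply: IHm => //; lia.
Qed.

End UDWords.

Theorem theorem4p2 (n : nat) (v : word n) (T : tree n) (u : 'S_n) :
  UD_word v -> ll_tree v T -> light_leaves T u <> [::] ->
  exists c : nat,
    [/\ coxlen u + c <= size v,
        ~~ odd (size v - coxlen u - c)
      & Rtilde T u =
          ('X^c * ('X^2 + 1) ^+ (size v - coxlen u - c)./2)%R].
Proof.
move=> [I [J [t [-> sI sJ]]]] llT /Rtilde_neq0; rewrite (Rtilde_leaf_poly u llT).
(* Having a light leaf excludes the zero alternative. *)
have [-> //|[c [k [<- ->]]] _] := factored_UD sI sJ u.
exists c; have -> : c + k.*2 + coxlen u - coxlen u - c = k.*2 by lia.
by rewrite odd_double doubleK; split=> //; lia.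
Qed.
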